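(* An overpartition of $n$ is a non-increasing sequence of positive integers summing to $n$ in which the first occurrence of each distinct value may be overlined (so each value $m$ appears overlined at most once, as $\overline{m}$). For a positive integer $n$, let $\overline{F}_1(n)$ be the total number of parts equal to $1$ or $\overline{1}$ (counted with multiplicity) over all overpartitions of $n$. For a positive integer $k$, let $\overline{G}_k(n)$ be the sum, over all overpartitions $\pi$ of $n$, of the number of values $m$ such that the total number of parts of $\pi$ equal to $m$ or $\overline{m}$ is at least $k$. Then for $n=1,2,\dots$, $$\overline{F}_1(n)=\overline{G}_1(n)-\overline{G}_3(n).$$
   Context: For example, the overpartition $3+2+2+\overline{2}+1+\overline{1}$ of $11$ has the value $2$ occurring three times in total, and this value contributes $1$ to $\overline{G}_k(11)$ for $k=1,2,3$. *)

(* Defs.v *)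
From mathcomp Require Import all_boot all_order all_algebra.

Set Implicit Arguments.
Unset Strict Implicit.
Unset Printing Implicit Defensive.

Local Open Scope nat_scope.

(* [(m, true)] is the overlined part, [(m, false)] the plain part. *)
Definition part : Type := (nat * bool)%type.

Definition values (s : seq part) : seq nat := [seq p.1 | p <- s].

(* An overlined entry at position [i] must be the first occurrence of its
   value: [index] returns the first position at which a value occurs. *)
Definition is_overpartition (n : nat) (s : seq part) : bool :=
  [&& sorted geq (values s),
      all (fun m => 0 < m) (values s),
      sumn (values s) == n
    & [forall i : 'I_(size s),
        (nth (0, false) s i).2 ==>
          (index (nth (0, false) s i).1 (values s) == i)]].

Definition part_of_bounded (n : nat) (p : 'I_n.+1 * bool) : part :=
  (val p.1, p.2).

(* Parts and length are bounded by [n], so this finite search lists every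
   overpartition of [n] exactly once; see [mem_overpartitions] and
   [uniq_overpartitions]. *)
Definition overpartitions (n : nat) : seq (seq part) :=
  [seq s <- [seq map (@part_of_bounded n) (val b)
            | b <- enum {: n.-bseq ('I_n.+1 * bool)}]
  | is_overpartition n s].

Definition mult (m : nat) (s : seq part) : nat :=
  count (fun p : part => p.1 == m) s.

Definition num_values_atleast (k : nat) (s : seq part) : nat :=
  size [seq m <- undup (values s) | k <= mult m s].

Definition Fbar1 (n : nat) : nat := \sum_(s <- overpartitions n) mult 1 s.

(* Intended for [k > 0]: only values that occur in [s] are counted. *)
Definition Gbar (k n : nat) : nat :=
  \sum_(s <- overpartitions n) num_values_atleast k s.

Lemma part_of_bounded_inj n : injective (@part_of_bounded n).
Proof. by move=> [a b] [c d] [/val_inj -> ->]. Qed.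

Lemma uniq_overpartitions n : uniq (overpartitions n).
Proof.
apply: filter_uniq; rewrite map_inj_uniq ?enum_uniq // => b c.
by move/(inj_map (@part_of_bounded_inj n))/val_inj.
Qed.

Lemma size_leq_sumn (s : seq nat) :
  all (fun m => 0 < m) s -> size s <= sumn s.
Proof.
elim: s => //= m s IHs /andP[m_gt0 /IHs les].
by rewrite -add1n leq_add.
Qed.

Lemma mem_leq_sumn (s : seq nat) m : m \in s -> m <= sumn s.
Proof.
elim: s => //= a s IHs; rewrite inE => /orP[/eqP-> | /IHs le_m].
  exact: leq_addr.
exact: leq_trans le_m (leq_addl _ _).
Qed.

Lemma mem_overpartitions n s :
  (s \in overpartitions n) = is_overpartition n s.
Proof.
rewrite mem_filter andb_idr // => /and4P[_ s_gt0 /eqP sumE _].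
have les : size s <= n.
  by rewrite -sumE -(size_map fst) size_leq_sumn.
pose t : seq ('I_n.+1 * bool) := [seq (inord p.1, p.2) | p <- s].
have let_n : size t <= n by rewrite size_map.
apply/mapP; exists (Bseq let_n); first by rewrite mem_enum.
rewrite /= /t -map_comp -[LHS]map_id; apply/eq_in_map => -[m c] sp /=.
rewrite /part_of_bounded /= inordK // ltnS -sumE.
by apply: mem_leq_sumn; apply/mapP; exists (m, c).
Qed.

(* Main.v *)
(* Adding a part [p] is a bijection from the overpartitions of [n] (those
   without [p], if [p] is overlined) to the overpartitions of [n + p.1] that
   contain [p]. Let P(n) be the number of overpartitions of [n], g_m(n) the
   number of those containing an overlined [m], and c_m the multiplicity of [m].
   Adding overlined and plain parts gives
     g_m(n) + g_m(n - m) = P(n - m),  #{c_m >= 1}(n) = 2 g_m(n),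
     #{c_m >= k + 2}(n) = #{c_m >= k + 1}(n - m),
   so that [m] contributes 2 (P(n - m) - P(n - 2m)) to G_1(n) - G_3(n).
   On the other side F_1(n) = F_1(n - 2) + 2 P(n - 1), and the sum over [m] of
   these contributions satisfies the same recurrence. *)
Require Import Defs.
From mathcomp Require Import all_boot all_order all_algebra.
From mathcomp Require Import zify.

Local Open Scope nat_scope.

(** * Overpartitions as pairwise ordered sequences *)

(* Pairwise form of the overlining condition: an overlined part must not be
   preceded by a part of the same value. *)
Definition before (p q : part) : bool :=
  (q.1 <= p.1) && (q.2 ==> (q.1 != p.1)).

Lemma before_trans : transitive before.
Proof. by move=> [m b] [n c] [p d]; rewrite /before /=; lia. Qed.

Lemma before_anti : antisymmetric before.
Proof.
move=> [m b] [n c]; rewrite /before /= => H.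
have mn : m = n by lia.
by subst n; congr pair; case: b c H => [] []; lia.
Qed.

(** The only incomparable pair is an overlined part with itself. *)
Lemma before_total p q : ~~ before q p -> p != q \/ ~~ p.2 -> before p q.
Proof.
case: p q => [m b] [n c]; rewrite -pair_eqE /before /pair_eq /=.
by case: b c => [] []; lia.
Qed.

Lemma is_overpartitionE n s :
  is_overpartition n s =
  [&& pairwise before s, all (fun m => 0 < m) (values s) & sumn (values s) == n].
Proof.
suff <- : sorted geq (values s) &&
   [forall i : 'I_(size s), (nth (0, false) s i).2 ==>
          (index (nth (0, false) s i).1 (values s) == i)] = pairwise before s.
  rewrite /is_overpartition; case: (sorted _ _) => //=.
  by rewrite [RHS]andbC -andbA.
rewrite sorted_pairwise; last by move=> x y z /=; lia.
elim: s => [|p s IHs] /=; first by apply/forallP => -[].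
rewrite -IHs; apply/andP/andP => [[/andP[/allP le_p srt] /forallP fst_p]|].
- split; last first.
    rewrite srt; apply/forallP => i; apply/implyP => ov.
    (* Position [i] of [s] is position [i + 1] of [p :: s]. *)
    have := fst_p (lift ord0 i); rewrite /= ov /=.
    by case: ifP => // _ ; rewrite eqSS.
  apply/allP => q qs; rewrite /before.
  rewrite [_ <= _]le_p ?map_f //=; apply/implyP => ov.
  have lt_q : (index q s).+1 < size (p :: s) by rewrite /= ltnS index_mem.
  have := fst_p (Ordinal lt_q); rewrite /= nth_index // ov /=.
  by rewrite (eq_sym q.1); case: (p.1 =P q.1).
- case=> /allP bef /andP[srt /forallP fst_s]; split.
    rewrite srt andbT; apply/allP => _ /mapP[q qs ->].
    by have /andP[] := bef _ qs.
  apply/forallP => -[[|i] lt_i] /=; first by rewrite eqxx implybT.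
  apply/implyP => ov; have := fst_s (Ordinal (lt_i : i < size s)).
  rewrite /= ov /= => /eqP->.
  have /andP[_] := bef _ (mem_nth (0, false) (lt_i : i < size s)).
  by rewrite ov /= eq_sym => /negPf->.
Qed.

(** An overpartition is determined by its multiset of parts: [before], though not reflexive, is
    transitive and antisymmetric. *)
Lemma pairwise_before_perm_eq s t :
  pairwise before s -> pairwise before t -> perm_eq s t -> s = t.
Proof.
rewrite -!(sorted_pairwise before_trans).
exact: sorted_eq before_trans before_anti _ _.
Qed.

(** * Adding and removing a part *)

Definition add_part (p : part) (s : seq part) : seq part :=
  [seq q <- s | before q p] ++ p :: [seq q <- s | ~~ before q p].

Lemma perm_add_part p s : perm_eq (add_part p s) (p :: s).
Proof. by rewrite perm_catC /= perm_cons perm_catC perm_filterC. Qed.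

Lemma pairwise_add_part p s :
  (p \notin s) || ~~ p.2 -> pairwise before s -> pairwise before (add_part p s).
Proof.
move=> new_p bef_s; rewrite pairwise_cat /= !pairwise_filter // !andbT.
have bef_p : all (before p) [seq q <- s | ~~ before q p].
  apply/allP => q; rewrite mem_filter => /andP[nbef qs].
  apply: before_total nbef _; case/orP: new_p => [pNs | ->]; last by right.
  by left; apply: contraNneq pNs => ->.
rewrite bef_p !andbT; apply/allrelP => q r; rewrite mem_filter inE => /andP[bef_q _].
case/predU1P => [-> // | /(allP bef_p)]; exact: before_trans bef_q.
Qed.

Lemma add_part_overpartition n p s :
    0 < p.1 -> (p \notin s) || ~~ p.2 ->
  is_overpartition n s -> is_overpartition (n + p.1) (add_part p s).
Proof.
move=> p_gt0 new_p; rewrite !is_overpartitionE => /and3P[bef pos /eqP sum_s].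
have eq_v := perm_map fst (perm_add_part p s).
rewrite pairwise_add_part //= (perm_all _ eq_v) (perm_sumn eq_v) /=.
by rewrite p_gt0 pos sum_s addnC eqxx.
Qed.

Lemma pairwise_before_count_mem (p : part) s :
  p.2 -> pairwise before s -> count_mem p s <= 1.
Proof.
move=> ov; elim: s => //= q s IHs /andP[/allP bef /IHs].
case: eqP => // eq_qp _; rewrite (count_memPn _) //.
by apply/negP => /bef; rewrite /before ov eq_qp eqxx andbF.
Qed.

Lemma rem_overpartition n p s :
    p \in s -> is_overpartition (n + p.1) s ->
  [&& is_overpartition n (rem p s), (p \notin rem p s) || ~~ p.2
    & add_part p (rem p s) == s].
Proof.
move=> ps; rewrite !is_overpartitionE => /and3P[bef pos /eqP sum_s].
have eq_s := perm_to_rem ps; have eq_v := perm_map fst eq_s.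
have bef_rem : pairwise before (rem p s).
  exact: subseq_pairwise (rem_subseq p s) bef.
have new_p : (p \notin rem p s) || ~~ p.2.
  rewrite orbC -implybE; apply/implyP => ov.
  have := pairwise_before_count_mem p s ov bef.
  by rewrite -has_pred1 has_count (permP eq_s) /= eqxx; case: count.
move: pos sum_s; rewrite bef_rem new_p /= (perm_all _ eq_v) (perm_sumn eq_v) /=.
case/andP=> _ -> /eqP; rewrite addnC eqn_add2r => -> /=.
apply/eqP/pairwise_before_perm_eq => //; first exact: pairwise_add_part.
by apply: perm_trans (perm_add_part _ _) _; rewrite perm_sym.
Qed.

(** The bijection [add_part p] in weighted form. Invariance of [h] under permutation allows [p :: s]
    in place of [add_part p s]. *)
Lemma sum_overpartitions_mem n p (h : seq part -> nat) :
    0 < p.1 -> (forall s t, perm_eq s t -> h s = h t) ->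
  \sum_(s <- overpartitions (n + p.1) | p \in s) h s =
  \sum_(s <- overpartitions n | (p \notin s) || ~~ p.2) h (p :: s).
Proof.
move=> p_gt0 h_perm; rewrite -big_filter.
under [RHS]eq_bigr => s _ do rewrite -(h_perm _ _ (perm_add_part p s)).
rewrite -[RHS]big_filter -(big_map (add_part p) xpredT).
apply: perm_big; apply: uniq_perm.
- by rewrite filter_uniq ?uniq_overpartitions.
- rewrite map_inj_in_uniq ?(filter_uniq _ (uniq_overpartitions _)) // => s t.
  rewrite mem_filter [t \in _]mem_filter !mem_overpartitions !is_overpartitionE.
  case/and3P=> _ bef_s _ /and3P[_ bef_t _] eq_st.
  apply: pairwise_before_perm_eq => //; rewrite -(perm_cons p).
  rewrite -(permPl (perm_add_part p s)) eq_st; exact: perm_add_part.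
- move=> s; apply/idP/mapP => [|[t]].
    rewrite mem_filter mem_overpartitions => /andP[ps].
    case/(rem_overpartition n p s ps)/and3P=> ov new_p /eqP eq_s.
    by exists (rem p s); rewrite // mem_filter new_p mem_overpartitions.
  rewrite mem_filter mem_overpartitions => /andP[new_p ov] ->.
  rewrite mem_filter mem_overpartitions.
  by rewrite add_part_overpartition // (perm_mem (perm_add_part p t)) mem_head.
Qed.

(** * Counting by the multiplicity of a fixed value *)

Lemma overpartition_value_gt n m b s :
  n < m -> s \in overpartitions n -> ((m, b) \in s) = false.
Proof.
move=> lt_nm; rewrite mem_overpartitions is_overpartitionE.
case/and3P=> _ _ /eqP sum_s; apply/negP => /(map_f fst)/mem_leq_sumn /=.
by rewrite -/(values s) sum_s leqNgt lt_nm.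
Qed.

Lemma mult_count m s : mult m s = count_mem (m, false) s + count_mem (m, true) s.
Proof.
elim: s => //= -[n b] s; rewrite /mult /= => ->.
by rewrite -!pair_eqE /pair_eq /=; case: b; case: eqP; rewrite ?andbF /=; lia.
Qed.

Lemma count_overlined n m s :
  s \in overpartitions n -> count_mem (m, true) s = ((m, true) \in s).
Proof.
rewrite mem_overpartitions is_overpartitionE => /and3P[bef _ _].
have := pairwise_before_count_mem (m, true) s isT bef.
by rewrite -has_pred1 has_count; case: count => [|[]].
Qed.

Lemma mult_perm m s t : perm_eq s t -> mult m s = mult m t.
Proof. by move/permP; apply. Qed.

Definition num_overlined (m n : nat) : nat :=
  \sum_(s <- overpartitions n) ((m, true) \in s).

Definition num_atleast (m k n : nat) : nat :=
  \sum_(s <- overpartitions n) (k <= mult m s).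

(* By [num_plainD] and [num_plain_gt] this is P(n - m), read as 0 when n < m,
   for every [m > 0]. *)
Definition num_plain (m n : nat) : nat :=
  \sum_(s <- overpartitions n) ((m, false) \in s).

Lemma sum_plain m n (h : seq part -> nat) :
    0 < m -> (forall s t, perm_eq s t -> h s = h t) ->
  \sum_(s <- overpartitions (n + m)) ((m, false) \in s) * h s =
  \sum_(s <- overpartitions n) h ((m, false) :: s).
Proof.
move=> m_gt0 h_perm; rewrite -[m in n + m]/(m, false).1.
rewrite [RHS](eq_bigl (fun s => ((m, false) \notin s) || ~~ false)); last first.
  by move=> s; rewrite orbT.
rewrite -sum_overpartitions_mem // [RHS]big_mkcond.
by apply: eq_bigr => s _; case: ifP; rewrite ?mul1n.
Qed.

Lemma num_plainD m n : 0 < m -> num_plain m (n + m) = size (overpartitions n).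
Proof.
move=> m_gt0; rewrite -sum1_size -(sum_plain m n (fun=> 1)) //.
by apply: eq_bigr => s _; rewrite muln1.
Qed.

Lemma num_plain_gt m n : n < m -> num_plain m n = 0.
Proof.
move=> lt_nm; rewrite /num_plain big_seq big1 // => s so.
by rewrite (overpartition_value_gt n).
Qed.

Lemma num_plain_shift m d n :
  0 < m -> num_plain (m + d) (n + d) = num_plain m n.
Proof.
move=> m_gt0; case: (leqP m n) => [/subnK<- | lt_nm].
  by rewrite -addnA !num_plainD // addn_gt0 m_gt0.
by rewrite !num_plain_gt // ltn_add2r.
Qed.

Lemma num_overlined_gt m n : n < m -> num_overlined m n = 0.
Proof.
move=> lt_nm; rewrite /num_overlined big_seq big1 // => s so.
by rewrite (overpartition_value_gt n).
Qed.

Lemma num_overlinedD m n :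
  0 < m -> num_overlined m (n + m) + num_overlined m n = size (overpartitions n).
Proof.
move=> m_gt0.
have -> : num_overlined m (n + m) =
    \sum_(s <- overpartitions n) ((m, true) \notin s).
  (* The added [|| false] matches the side condition of [sum_overpartitions_mem], as [~~ p.2] is
     false for an overlined part. *)
  under eq_bigr => s _ do rewrite -[X in nat_of_bool X]orbF.
  rewrite -big_mkcond -(sum_overpartitions_mem n (m, true) (fun=> 1)) //.
  by rewrite [RHS]big_mkcond.
rewrite -big_split -sum1_size; apply: eq_bigr => s _ /=.
by case: (_ \in _).
Qed.

Lemma num_atleast_gt m k n : n < m -> num_atleast m k.+1 n = 0.
Proof.
move=> lt_nm; rewrite /num_atleast big_seq big1 // => s so.
rewrite mult_count !(count_memPn _) // ?(overpartition_value_gt n) //.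
Qed.

(** Inclusion-exclusion over plain and overlined [m]: removing a plain [m] turns the overpartitions
    of n + m with both into those of n with an overlined [m], and P(n) - g_m(n) = g_m(n + m). *)
Lemma num_atleast1 m n : 0 < m -> num_atleast m 1 n = (num_overlined m n).*2.
Proof.
move=> m_gt0; case: (ltnP n m) => [lt_nm | /subnK<-].
  by rewrite num_atleast_gt // num_overlined_gt.
move: (n - m) => {}n.
suff : num_atleast m 1 (n + m) + num_overlined m n =
       num_overlined m (n + m) + num_plain m (n + m).
  by have := num_overlinedD m n m_gt0; rewrite num_plainD //; lia.
have -> : num_overlined m n =
    \sum_(s <- overpartitions (n + m)) ((m, false) \in s) * ((m, true) \in s).
  rewrite (sum_plain m n (fun s => nat_of_bool ((m, true) \in s))) // => [|s t].
    by apply: eq_bigr => s _; rewrite inE -pair_eqE /= andbF.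
  by move/perm_mem->.
rewrite -!big_split; apply: eq_bigr => s _ /=.
rewrite mult_count addn_gt0 -!has_count !has_pred1.
by do 2!case: (_ \in _).
Qed.

(** Among two or more copies of [m] at most one is overlined, so a plain one can be removed. *)
Lemma num_atleastD m k n :
  0 < m -> num_atleast m k.+2 (n + m) = num_atleast m k.+1 n.
Proof.
move=> m_gt0.
have -> : num_atleast m k.+1 n =
    \sum_(s <- overpartitions n) (k.+2 <= mult m ((m, false) :: s)).
  by apply: eq_bigr => s _; rewrite /mult /= eqxx.
rewrite -(sum_plain m n (fun s => nat_of_bool (k.+2 <= mult m s))) //; last first.
  by move=> s t /mult_perm->.
rewrite /num_atleast [LHS]big_seq [RHS]big_seq.
(* Without a plain [m] the multiplicity is at most 1, so the indicator vanishes. *)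
apply: eq_bigr => s so; case: (boolP (_ \in s)); rewrite ?mul1n // => /count_memPn.
by rewrite mult_count (count_overlined _ _ _ so) => ->; case: (_ \in s).
Qed.

(** The difference 2 g_m(n) - 2 g_m(n - 2m) becomes 2 (P(n - m) - P(n - 2m)) on adding and
    subtracting 2 g_m(n - m). Here [num_plain m.*2 n] serves as P(n - 2m); the cases are n < m, m <=
    n < 2m and 2m <= n. *)
Lemma num_atleast1_3 m n : 0 < m ->
  num_atleast m 1 n + (num_plain m.*2 n).*2 =
  num_atleast m 3 n + (num_plain m n).*2.
Proof.
move=> m_gt0; have m2_gt0 : 0 < m.*2 by rewrite double_gt0.
case: (ltnP n m) => [lt_nm | /subnK<-].
  rewrite !num_atleast_gt // !num_plain_gt //; lia.
move: (n - m) => {}n; rewrite num_atleast1 // num_atleastD // num_plainD //.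
rewrite -(num_overlinedD m n) // -(addnn m); case: (ltnP n m) => [lt_nm | /subnK<-].
  rewrite num_atleast_gt // num_plain_gt ?ltn_add2r // (num_overlined_gt m n) //; lia.
move: (n - m) => {}n; rewrite num_atleastD // num_atleast1 //.
rewrite -addnA num_plainD ?addn_gt0 ?m_gt0 // -(num_overlinedD m n) //; lia.
Qed.

(** * The recurrence for F_1 *)

Lemma Fbar1E n : Fbar1 n =
  \sum_(s <- overpartitions n) count_mem (1, false) s + num_overlined 1 n.
Proof.
rewrite /Fbar1 -big_split [LHS]big_seq [RHS]big_seq.
apply: eq_bigr => s so /=.
by rewrite mult_count (count_overlined _ _ _ so).
Qed.

Lemma sum_count_plainD m n : 0 < m ->
  \sum_(s <- overpartitions (n + m)) count_mem (m, false) s =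
  \sum_(s <- overpartitions n) count_mem (m, false) s + size (overpartitions n).
Proof.
move=> m_gt0; rewrite -sum1_size -big_split /=.
transitivity (\sum_(s <- overpartitions n) count_mem (m, false) ((m, false) :: s)).
  rewrite -(sum_plain m n (count_mem (m, false))) // => [|s t /permP-> //].
  apply: eq_bigr => s _; case: (boolP (_ \in s)); rewrite ?mul1n //.
  by move/count_memPn->; rewrite muln0.
by apply: eq_bigr => s _; rewrite /= eqxx addnC.
Qed.

(** In two steps the plain ones gain P(n + 1) + P(n) and the overlined ones gain P(n + 1) - P(n). *)
Lemma Fbar1SS n : Fbar1 n.+2 = Fbar1 n + (size (overpartitions n.+1)).*2.
Proof.
rewrite !Fbar1E.
have := sum_count_plainD 1 n isT; have := sum_count_plainD 1 n.+1 isT.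
have := num_overlinedD 1 n isT; have := num_overlinedD 1 n.+1 isT.
rewrite !addn1; lia.
Qed.

Lemma Fbar1_0 : Fbar1 0 = 0.
Proof.
rewrite /Fbar1 big_seq big1 // => s so.
by rewrite mult_count !(count_memPn _) // (overpartition_value_gt 0).
Qed.

Lemma Fbar1_1 : Fbar1 1 = (size (overpartitions 0)).*2.
Proof.
have := sum_count_plainD 1 0 isT; have := num_overlinedD 1 0 isT.
have := Fbar1_0; have := Fbar1E 0; rewrite (Fbar1E 1) !add0n; lia.
Qed.

Lemma Fbar1_num_plain n :
  Fbar1 n + \sum_(1 <= m < n.+1) (num_plain m.*2 n).*2 =
  \sum_(1 <= m < n.+1) (num_plain m n).*2.
Proof.
elim/ltn_ind: n => -[_ | [_ | n /(_ n (leqnSn _)) IHn]].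
- by rewrite Fbar1_0 !big_nil.
- by rewrite Fbar1_1 !big_nat1 num_plain_gt // -[1]/(0 + 1) num_plainD // addn0.
(* P(n + 2 - 2m) and P(n + 2 - m) become the terms for n after shifting m by 1 and by 2. The left
   sum thus loses its first and last terms, the right sum its first two. *)
rewrite [in LHS]big_ltn // big_add1 /= big_nat_recr //=.
rewrite [in RHS]big_ltn // [in RHS]big_ltn // 2![in RHS]big_add1 /=.
have shift_even : \sum_(1 <= m < n.+1) (num_plain m.+1.*2 n.+2).*2 =
                  \sum_(1 <= m < n.+1) (num_plain m.*2 n).*2.
  rewrite [LHS]big_nat [RHS]big_nat; apply: eq_bigr => m /andP[m_gt0 _].
  by rewrite doubleS -addn2 -(addn2 n) num_plain_shift ?double_gt0.
have shift : \sum_(1 <= m < n.+1) (num_plain m.+2 n.+2).*2 =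
             \sum_(1 <= m < n.+1) (num_plain m n).*2.
  rewrite [LHS]big_nat [RHS]big_nat; apply: eq_bigr => m /andP[m_gt0 _].
  by rewrite -addn2 -(addn2 n) num_plain_shift.
(* The last left term is 0. The first left term cancels the second right one, leaving 2 P(n + 1). *)
rewrite shift_even shift Fbar1SS (num_plain_gt n.+2.*2); last by lia.
have := num_plainD 1 n.+1 isT; rewrite addn1 -IHn -[1.*2]/2; lia.
Qed.

(** * G_k as a sum over all values, and the conclusion *)

(** As k > 0, a counted value occurs in [s], hence lies between 1 and n. The range no longer depends
    on [s], so the sums can be exchanged. *)
Lemma num_values_atleastE k n s : 0 < k -> s \in overpartitions n ->
  num_values_atleast k s = \sum_(1 <= m < n.+1) (k <= mult m s).
Proof.
move=> k_gt0; rewrite mem_overpartitions is_overpartitionE.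
case/and3P=> _ /allP pos /eqP sum_s.
rewrite -big_mkcond -big_filter sum1_size; apply/perm_size/uniq_perm.
- by rewrite filter_uniq ?undup_uniq.
- by rewrite filter_uniq ?iota_uniq.
move=> m; rewrite !mem_filter mem_undup mem_index_iota.
case: (leqP k _) => //= le_k; have ms : m \in values s.
  have := leq_trans k_gt0 le_k; rewrite -has_count => /hasP[p ps /eqP<-].
  exact: map_f.
by rewrite ms pos //= ltnS -sum_s mem_leq_sumn.
Qed.

Lemma GbarE k n : 0 < k -> Gbar k n = \sum_(1 <= m < n.+1) num_atleast m k n.
Proof.
move=> k_gt0; rewrite /num_atleast exchange_big /= /Gbar [LHS]big_seq [RHS]big_seq.
by apply: eq_bigr => s; exact: num_values_atleastE.
Qed.

Local Open Scope ring_scope.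

Theorem theorem8 (n : nat) (hn : (0 < n)%N) :
  (Fbar1 n)%:Z = (Gbar 1 n)%:Z - (Gbar 3 n)%:Z.
Proof.
suff : (Gbar 1 n + \sum_(1 <= m < n.+1) (num_plain m.*2 n).*2 =
        Gbar 3 n + \sum_(1 <= m < n.+1) (num_plain m n).*2)%N.
  by have := Fbar1_num_plain n; lia.
rewrite !GbarE // -!big_split [LHS]big_nat [RHS]big_nat.
by apply: eq_bigr => m /andP[m_gt0 _]; exact: num_atleast1_3.
Qed.
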